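(* Let $\{X(t),\,-\infty<t<\infty\}$ be a real-valued, zero mean, mean square continuous, wide sense stationary stochastic process with covariance function $C(\cdot)$ and spectral density $\phi(\cdot)$, and let $\widehat{\phi}_n(\cdot)$ be the estimator of $\phi(\cdot)$ defined in the context from a kernel $K$, window widths $b_n>0$ and sampling rates $\rho_n>0$. Suppose that: (1) the function $h_0(t)=\sup_{s\ge|t|}|C(s)|$ is integrable over the real line; (2) $K(\cdot)$ is continuous, even, square integrable and bounded (in absolute value) by a non-negative, even and integrable function having a unique maximum at $0$; further, $K(0)=1$; (3) $b_n\to0$ and $nb_n\to\infty$ as $n\to\infty$; (4) $\rho_n\to\infty$ and $\rho_nb_n\to0$ as $n\to\infty$. Then the bias $E[\widehat{\phi}_n(\lambda)]-\phi(\lambda)$ tends to zero as $n\to\infty$, uniformly in $\lambda$ over any closed and finite interval.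
   Context: The covariance function is $C(t)=E[X(s)X(s+t)]$ and the spectral density is $\phi(\lambda)=\frac1{2\pi}\int_{-\infty}^\infty C(t)e^{-it\lambda}\,dt$. The process is sampled uniformly at rate $\rho_n$, the sample size being $n$. The estimator is $$\widehat{\phi}_n(\lambda)=\frac{1}{2\pi\rho_n}\sum_{|v|<n}\widehat{\gamma}_n(v)K(b_nv)e^{-\frac{iv\lambda}{\rho_n}}\,1_{[-\pi\rho_n,\pi\rho_n]}(\lambda),$$ where $v$ ranges over integers, $1_A$ is the indicator function of $A$, and $$\widehat{\gamma}_n(v)=\frac1n\sum_{j=1}^{n-|v|}X\left(\frac{j}{\rho_n}\right)X\left(\frac{j+|v|}{\rho_n}\right),\qquad |v|\le n-1.$$ *)

(* Defs.v *)
From HB Require Import structures.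
From mathcomp Require Import all_boot all_order all_algebra.
From mathcomp Require Import all_classical all_reals all_analysis.
From mathcomp Require Import complex.
Set Implicit Arguments.
Unset Strict Implicit.
Unset Printing Implicit Defensive.
Import Order.TTheory GRing.Theory Num.Theory.
Import numFieldNormedType.Exports.
Local Open Scope classical_set_scope.
Local Open Scope ring_scope.
Local Open Scope complex_scope.

Section ComplexValued.
Context {R : realType}.

Definition expi (x : R) : R[i] := cos x +i* sin x.

(* The library integrates real-valued functions only, so complex integrals and
   expectations are taken componentwise. *)
Definition cintegral (f : R -> R[i]) : R[i] :=
  (\int[lebesgue_measure]_(t in setT) complex.Re (f t))
  +i* (\int[lebesgue_measure]_(t in setT) complex.Im (f t)).

Definition cexpectation d (T : measurableType d) (P : probability T R)
    (Z : T -> R[i]) : R[i] :=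
  fine 'E_P[fun w => complex.Re (Z w)]%E
  +i* fine 'E_P[fun w => complex.Im (Z w)]%E.

End ComplexValued.

Section Process.
Context d (T : measurableType d) (R : realType) (P : probability T R).
Implicit Types X : R -> {RV P >-> R}.

Definition zero_mean X := forall t, 'E_P[X t]%E = 0%E.

Definition mean_square_continuous X :=
  forall t, 'E_P[fun w => ((X s w - X t w) ^+ 2)%R]%E @[s --> t] --> 0%E.

Definition wide_sense_stationary X :=
  [/\ forall t, (X t : T -> R) \in Lfun P 2%:E,
      forall s t, 'E_P[X s]%E = 'E_P[X t]%E
    & forall s t h,
        covariance P (X s) (X (s + h)) = covariance P (X t) (X (t + h))].

(* No centring: used only for zero mean processes. *)
Definition is_covariance_function X (C : R -> R) :=
  forall s t, 'E_P[fun w => (X s w * X (s + t) w)%R]%E = (C t)%:E.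

End Process.

Section SpectralDensity.
Context {R : realType}.

Definition spectral_density (C : R -> R) (lambda : R) : R[i] :=
  ((2 * pi)^-1)%:C * cintegral (fun t => (C t)%:C * expi (- (t * lambda))).

(* Extended-real supremum: finiteness is not presupposed (the real-valued sup
   of an unbounded set would be the junk value 0). *)
Definition h0 (C : R -> R) (t : R) : \bar R :=
  ereal_sup [set (`|C s|)%:E | s in [set s | `|t| <= s]].

End SpectralDensity.

Section Estimator.
Context d (T : measurableType d) (R : realType) (P : probability T R).
Variables (X : R -> {RV P >-> R}) (K : R -> R) (b rho : R^nat).

Definition gamma_hat (n : nat) (v : int) (w : T) : R :=
  n%:R^-1 * \sum_(1 <= j < (n - `|v|).+1)
              X (j%:R / rho n) w * X ((j + `|v|)%:R / rho n) w.

Definition phi_hat (n : nat) (lambda : R) (w : T) : R[i] :=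
  ((2 * pi * rho n)^-1)%:C *
  (\sum_(v \in [set v : int | `|v| < n%:Z])
     (gamma_hat n v w * K (b n * v%:~R))%:C *
     expi (- (v%:~R * lambda / rho n)) *
     (\1_(`[- (pi * rho n), pi * rho n]) lambda)%:C).

Definition bias (C : R -> R) (n : nat) (lambda : R) : R[i] :=
  cexpectation P (phi_hat n lambda) - spectral_density C lambda.

End Estimator.

(* Integrability of the majorant g entails its Borel measurability; since K is
   continuous, a Lebesgue measurable majorant can be modified on a null set into
   a Borel one with the same properties. *)
Definition kernel_condition {R : realType} (K : R -> R) :=
  [/\ continuous K,
      forall x, K (- x) = K x,
      lebesgue_measure.-integrable setT (fun x => (K x ^+ 2)%:E),
      exists g : R -> R,
        [/\ forall x, 0 <= g x,
            forall x, g (- x) = g x,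
            lebesgue_measure.-integrable setT (EFin \o g),
            forall x, x != 0 -> g x < g 0
          & forall x, `|K x| <= g x]
    & K 0 = 1].

(* Main.v *)
Require Import Defs.
From HB Require Import structures.
From mathcomp Require Import finmap all_boot all_order all_algebra.
From mathcomp Require Import all_classical all_reals all_analysis.
From mathcomp Require Import measurable_realfun complex.
From mathcomp Require Import lra ring zify.
Set Implicit Arguments.
Unset Strict Implicit.
Unset Printing Implicit Defensive.
Import Order.TTheory GRing.Theory Num.Theory.
Import numFieldNormedType.Exports.
Local Open Scope classical_set_scope.
Local Open Scope ring_scope.
Local Open Scope complex_scope.

(** The bias vanishes because the mean of the estimator is a Riemann sum for
the integral defining the spectral density, and these Riemann sums converge
in L1, which makes the convergence of their Fourier transforms uniform in the
frequency.

Taking expectations term by term, the mean of the estimator at [lambda] is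
[(2 pi rho_n)^-1 * \sum_v a_n(v) exp(- i v lambda / rho_n)] with
[a_n(v) = (1 - |v|/n)_+ C(v / rho_n) K(b_n v)] ([lag_weight]), as soon as
[|lambda| <= pi rho_n] ([biasE]).  To write the sum as an integral, each
real [t] is sent to the integer [v] obtained by rounding [t rho_n] away from
zero ([outward_index]).  The preimage of every [v != 0] is an interval of length
[1 / rho_n] ([lebesgue_measure_cell]), so that the sum is the integral of a step
function, up to the term [v = 0], which is [O(1 / rho_n)]
([Rintegral_step_function]).

Rounding outward is what makes the domination immediate: the lag [v / rho_n]
attached to [t] satisfies [|v / rho_n| >= |t|], whence
[|C(v / rho_n)| <= h0(t)], and the step function [t |-> a_n(v)] is dominated by
a multiple of the integrable [h0], the kernel being bounded.  It converges
pointwise to [C] because [C] and [K] are continuous, [K 0 = 1] and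
[v / rho_n] tends to [t], so that [b_n v = (rho_n b_n) (v / rho_n)] and
[|v| / n = |v / rho_n| (rho_n b_n) / (n b_n)] both tend to 0 ([lag_weight_cvg]).  Dominated convergence gives L1
convergence ([step_weight_cvg_L1]).

Finally, the cosine and sine are bounded by 1 and 1-Lipschitz, and
[|v / rho_n - t| <= 1 / rho_n]; replacing [v lambda / rho_n] by [t lambda] in
the trigonometric factor therefore costs at most [|lambda| / rho_n] times the
L1 norm of [C].  The real and imaginary parts of the bias are thus bounded by a
sequence depending on [lambda] only through a bound of [|lambda|]
([step_transform_error]).

The continuity of [C] comes from that of the process in mean square, through
the inequality [2 |E[YZ]| <= e E[Y^2] + E[Z^2] / e]. *)

(** * Finite sums of real integrals and second moments *)

Lemma integrable_sumr d (T : measurableType d) (R : realType)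
    (mu : {measure set T -> \bar R}) (D : set T) (I : Type) (s : seq I)
    (f : I -> T -> R) :
  measurable D -> (forall i, mu.-integrable D (EFin \o f i)) ->
  mu.-integrable D (EFin \o (fun x => \sum_(i <- s) f i x)).
Proof.
move=> mD fi.
have -> : EFin \o (fun x => \sum_(i <- s) f i x) =
    fun x => (\sum_(i <- s) (f i x)%:E)%E.
  by apply/funext => x; rewrite /= sumEFin.
by apply: (integrable_sum mD) => i _; exact: fi.
Qed.

Lemma Rintegral_sum d (T : measurableType d) (R : realType)
    (mu : {measure set T -> \bar R}) (D : set T) (I : Type) (s : seq I)
    (f : I -> T -> R) :
  measurable D -> (forall i, mu.-integrable D (EFin \o f i)) ->
  \int[mu]_(x in D) (\sum_(i <- s) f i x) = \sum_(i <- s) \int[mu]_(x in D) f i x.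
Proof.
move=> mD fi.
rewrite /Rintegral; under eq_integral do rewrite -sumEFin.
rewrite integral_sum//.
have E i : (\int[mu]_(x in D) (f i x)%:E)%E = (\int[mu]_(x in D) f i x)%:E.
  by rewrite fineK//; exact: integrable_fin_num (fi i).
by under eq_bigr do rewrite E; rewrite sumEFin.
Qed.

Section SecondMoments.
Context d (T : measurableType d) (R : realType) (mu : {measure set T -> \bar R}).
Implicit Types Y Z : T -> R.

Lemma Lfun2_integrable_mul Y Z : Y \in Lfun mu 2%:E -> Z \in Lfun mu 2%:E ->
  mu.-integrable setT (EFin \o (fun w => Y w * Z w)).
Proof. by move=> Y2 Z2; apply/Lfun1_integrable/Lfun2_mul_Lfun1. Qed.

(** Young's inequality, used instead of the Cauchy-Schwarz inequality: the free
    parameter [e] spares any square root. *)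
Lemma normr_Rintegral_mul_le Y Z (e : R) : 0 < e ->
  Y \in Lfun mu 2%:E -> Z \in Lfun mu 2%:E ->
  `|\int[mu]_w (Y w * Z w)| <=
  (e * (\int[mu]_w (Y w * Y w)) + e^-1 * \int[mu]_w (Z w * Z w)) / 2.
Proof.
move=> e0 Y2 Z2.
have iYY := Lfun2_integrable_mul Y2 Y2.
have iZZ := Lfun2_integrable_mul Z2 Z2.
have iYZ := Lfun2_integrable_mul Y2 Z2.
apply: le_trans (le_normr_Rintegral _ iYZ) _ => //.
have iZ (k : R) f : mu.-integrable setT (EFin \o f) ->
    mu.-integrable setT (EFin \o (fun w => k * f w)).
  by move=> fi; apply: (integrableZl measurableT k fi).
have -> : (e * (\int[mu]_w (Y w * Y w)) + e^-1 * \int[mu]_w (Z w * Z w)) / 2 =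
    \int[mu]_w (2^-1 * (e * (Y w * Y w) + e^-1 * (Z w * Z w))).
  rewrite RintegralZl//; last first.
    by apply: (integrableD measurableT (iZ e _ iYY) (iZ e^-1 _ iZZ)).
  rewrite RintegralD//; [|exact: iZ|exact: iZ].
  by rewrite !RintegralZl// mulrC.
apply: le_Rintegral => //.
- exact: integrable_norm.
- by apply: (iZ 2^-1); apply: (integrableD measurableT (iZ e _ iYY) (iZ e^-1 _ iZZ)).
move=> w _.
(* Young's inequality is this square expanded. *)
have : 0 <= (e * `|Y w| - `|Z w|) ^+ 2 / (2 * e).
  by rewrite divr_ge0 ?sqr_ge0// mulr_ge0// ltW.
have sqE (x : R) : x * x = `|x| * `|x|.
  by rewrite -normrM ger0_norm// -expr2 sqr_ge0.
rewrite normrM [Y w * _]sqE [Z w * _]sqE.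
have -> : (e * `|Y w| - `|Z w|) ^+ 2 / (2 * e) =
  2^-1 * (e * (`|Y w| * `|Y w|) + e^-1 * (`|Z w| * `|Z w|)) - `|Y w| * `|Z w|.
  by field; rewrite gt_eqF.
by rewrite subr_ge0.
Qed.

End SecondMoments.

(** * The covariance function of a stationary process *)

Section CovarianceFunction.
Context d (T : measurableType d) (R : realType) (P : probability T R).
Variables (X : R -> {RV P >-> R}) (C : R -> R).
Hypothesis X2 : forall t, (X t : T -> R) \in Lfun P 2%:E.
Hypothesis XC : is_covariance_function X C.

Lemma Rintegral_lag s t : \int[P]_w (X s w * X t w) = C (t - s).
Proof.
have := XC s (t - s); rewrite subrKC unlock => /(congr1 fine) /=.
by [].
Qed.

Lemma covariance_even t : C (- t) = C t.
Proof.
rewrite -[in RHS](subr0 t) -[- t](sub0r t) -!Rintegral_lag.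
by under eq_Rintegral do rewrite mulrC.
Qed.

Lemma covariance0_ge0 : 0 <= C 0.
Proof.
have := Rintegral_lag 0 0; rewrite subrr => <-.
by apply: Rintegral_ge0 => w _; rewrite -expr2 sqr_ge0.
Qed.

Lemma normr_covariance_le t : `|C t| <= C 0.
Proof.
have := normr_Rintegral_mul_le ltr01 (X2 0) (X2 t).
rewrite !Rintegral_lag !subr0 subrr invr1 !mul1r => /le_trans -> //.
lra.
Qed.

(** [C s - C t] is the product moment of [X 0] with the increment [X s - X t],
    which is small in mean square; the weight [a] makes the contribution of
    the fixed factor [X 0] at most half of the tolerance. *)
Lemma covariance_continuous : mean_square_continuous X -> continuous C.
Proof.
move=> msc t; apply/cvgrPdist_le => e e0.
have C0 := covariance0_ge0.
(* [C 0 + 1] rather than [C 0]: the process may vanish almost surely. *)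
pose a := e / (C 0 + 1).
have a0 : 0 < a by rewrite divr_gt0// ltr_wpDl.
have /fine_cvgP[_ D0] := msc t.
have {}D0 : \forall s \near t, \int[P]_w ((X s w - X t w) ^+ 2) <= a * e.
  have /cvgrPdist_le := D0 => /(_ (a * e) (mulr_gt0 a0 e0)).
  apply: filterS => s; rewrite sub0r normrN /= unlock => /(le_trans _) -> //.
  exact: ler_norm.
near=> s.
have Xd : (fun w => X s w - X t w) \in Lfun P 2%:E.
  have -> : (fun w => X s w - X t w) = (X s : T -> R) - (X t : T -> R) by [].
  by rewrite rpredB ?lee1n.
have -> : C t - C s = - \int[P]_w (X 0 w * (X s w - X t w)).
  under eq_Rintegral do rewrite mulrBr.
  by rewrite RintegralB//; try exact: Lfun2_integrable_mul;
    rewrite !Rintegral_lag !subr0 opprB.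
rewrite normrN; apply: le_trans (normr_Rintegral_mul_le a0 (X2 0) Xd) _.
rewrite Rintegral_lag subrr.
have aC : a * C 0 <= e.
  rewrite /a mulrAC ler_pdivrMr ?ltr_wpDl// ler_pM2l// lerDl//.
have aD : a^-1 * (\int[P]_w ((X s w - X t w) * (X s w - X t w))) <= e.
  rewrite ler_pdivrMl//.
  under eq_Rintegral do rewrite -expr2.
  by near: s.
lra.
Unshelve. all: by end_near. Qed.

End CovarianceFunction.

(** * Step functions obtained by rounding away from zero *)

Section Cells.
Context {R : realType}.
Notation mu := (@lebesgue_measure R).

(** Rounding away from zero, rather than to the nearest grid point, keeps
    [|t|] below the norm of the sampled lag, so that a majorant of [C] that
    decreases in [|t|] may be evaluated at [t] itself. *)
Definition outward_index (rho t : R) : int :=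
  if 0 <= t then Num.ceil (t * rho) else Num.floor (t * rho).

Definition cell (rho : R) (v : int) : set R := [set t | outward_index rho t = v].

Variables (rho : R) (rho_gt0 : 0 < rho).

Lemma norm_le_outward_index t : `|t| <= `|(outward_index rho t)%:~R / rho|.
Proof.
rewrite normrM [ `|rho^-1|]gtr0_norm ?invr_gt0// ler_pdivlMr//.
rewrite /outward_index; case: ifP => [t0|/negbT].
  have tr : 0 <= t * rho by rewrite mulr_ge0// ltW.
  rewrite [ `|t|]ger0_norm// ger0_norm ?ceil_ge//.
  by rewrite ler0z ceil_ge0 (lt_le_trans _ tr)// ltrN10.
rewrite -ltNge => t0.
rewrite [ `|t|]ltr0_norm// mulNr.
rewrite -normrN (le_trans _ (ler_norm _))// lerN2.
exact: floor_le.
Qed.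

Lemma outward_index_dist t : `|(outward_index rho t)%:~R / rho - t| <= rho^-1.
Proof.
have -> : (outward_index rho t)%:~R / rho - t =
    ((outward_index rho t)%:~R - t * rho) / rho.
  by field; rewrite gt_eqF.
rewrite normrM [ `|rho^-1|]gtr0_norm ?invr_gt0// ler_piMl// ?invr_ge0 ?ltW//.
rewrite /outward_index; case: ifP => [t0|_].
  have := ceil_itv (t * rho); rewrite rmorphB/= => /andP[h1 h2].
  rewrite ger0_norm ?subr_ge0//; lra.
have := floor_itv (t * rho); rewrite rmorphD/= => /andP[h1 h2].
rewrite ler0_norm ?subr_le0//; lra.
Qed.

(** The price of rounding outward: no interval is attached to the index 0, so
    that the term of index 0 is missing from the integral of a step function. *)
Lemma cell0 : cell rho 0 = [set 0].
Proof.
apply/seteqP; split => t; rewrite /cell /=; last first.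
  by move=> ->; rewrite /outward_index lexx mul0r ceil0.
move=> t0; have := norm_le_outward_index t; rewrite t0 mul0r normr0.
by rewrite normr_le0 => /eqP.
Qed.

Lemma cell_gt0 (v : int) : 0 < v ->
  cell rho v = `](v - 1)%:~R / rho, v%:~R / rho]%classic.
Proof.
move=> v0; apply/seteqP; split => t; rewrite /cell /outward_index /= in_itv /=.
  case: ifP => [t0 <-|/negbT].
    have /andP[h1 h2] := ceil_itv (t * rho).
    by rewrite ltr_pdivrMr// ler_pdivlMr// h1 h2.
  rewrite -ltNge => t0 tv; move: v0; rewrite -tv floor_gt0 => h.
  have : t * rho < 0 by rewrite pmulr_llt0.
  lra.
rewrite ltr_pdivrMr// ler_pdivlMr// => tv.
have t0 : 0 <= t.
  rewrite -(pmulr_lge0 _ rho_gt0); case/andP: tv => tv _; apply: ltW.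
  by apply: le_lt_trans tv; rewrite ler0z subr_ge0 -gtz0_ge1.
by rewrite t0; apply/eqP; rewrite ceil_eq.
Qed.

Lemma cell_lt0 (v : int) : v < 0 ->
  cell rho v = `[v%:~R / rho, (v + 1)%:~R / rho[%classic.
Proof.
move=> v0; apply/seteqP; split => t; rewrite /cell /outward_index /= in_itv /=.
  case: ifP => [t0 tv|/negbT].
    by move: v0; rewrite -tv ltNge ceil_ge0 (lt_le_trans (ltrN10 _))// mulr_ge0// ltW.
  rewrite -ltNge => t0 <-.
  have /andP[h1 h2] := floor_itv (t * rho).
  by rewrite ltr_pdivlMr// ler_pdivrMr// h1 h2.
rewrite ltr_pdivlMr// ler_pdivrMr// => tv.
have t0 : t < 0.
  rewrite -(pmulr_llt0 _ rho_gt0); case/andP: tv => _ tv.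
  by apply: lt_le_trans tv _; rewrite lerz0; lia.
by rewrite leNgt t0 /=; apply/eqP; rewrite floor_eq.
Qed.

(** The sigma-algebra is the one on which the Lebesgue measure is defined; the
    default one on [R], although convertible to it, has another display. *)
Lemma measurable_cell v : @measurable _ (measurableTypeR R) (cell rho v).
Proof.
have [v0|v0|->] := ltgtP v 0; first by rewrite cell_lt0.
- by rewrite cell_gt0.
- by rewrite cell0.
Qed.

Lemma lebesgue_measure_cell v : mu (cell rho v) = (if v == 0 then 0 else rho^-1)%:E.
Proof.
have rV0 : 0 < rho^-1 by rewrite invr_gt0.
have [v0|v0|->] := ltgtP v 0.
- rewrite cell_lt0// lebesgue_measure_itv /= lte_fin ltr_pM2r// ltr_int ltrDl ltr01.
  by rewrite -EFinB -mulrBl rmorphD/= addrC addKr mul1r.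
- rewrite cell_gt0// lebesgue_measure_itv /= lte_fin ltr_pM2r// ltr_int gtrBl ltr01.
  by rewrite -EFinB -mulrBl rmorphB/= opprB addrC subrK mul1r.
- by rewrite cell0 lebesgue_measure_set1.
Qed.

Variables (w : int -> R) (s : seq int).
Hypothesis s_uniq : uniq s.
Hypothesis w_supp : forall v, v \notin s -> w v = 0.

Lemma step_functionE t :
  w (outward_index rho t) = \sum_(v <- s) w v * \1_(cell rho v) t.
Proof.
have E v : \1_(cell rho v) t = (v == outward_index rho t)%:R :> R.
  rewrite indicE; congr ((nat_of_bool _)%:R); apply/idP/eqP; rewrite inE /cell /= => ->//.
under eq_bigr do rewrite E.
have [ts|ts] := boolP (outward_index rho t \in s).
  rewrite (bigD1_seq _ ts)//= eqxx mulr1 big1 ?addr0// => v /negPf ->.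
  by rewrite mulr0.
rewrite w_supp// big_seq big1// => v vs.
by rewrite (negPf (memPn ts _ vs)) mulr0.
Qed.

Lemma integrable_indic_cell v : mu.-integrable setT (EFin \o \1_(cell rho v)).
Proof.
apply/integrableP; split.
  by apply/measurable_EFinP/measurable_indic; exact: measurable_cell.
under eq_integral do rewrite /= ger0_norm//.
rewrite integral_indic//; last exact: measurable_cell.
by rewrite setIT [ltLHS]lebesgue_measure_cell ltry.
Qed.

Lemma integrable_cell_cst v :
  mu.-integrable setT (EFin \o (fun t => w v * \1_(cell rho v) t)).
Proof.
exact: (integrableZl measurableT (w v) (integrable_indic_cell v)).
Qed.

Lemma step_function_integrable :
  mu.-integrable setT (EFin \o (fun t => w (outward_index rho t))).
Proof.
have -> : (fun t => w (outward_index rho t)) =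
    (fun t => \sum_(v <- s) w v * \1_(cell rho v) t).
  by apply/funext => t; exact: step_functionE.
by apply: integrable_sumr => // v; exact: integrable_cell_cst.
Qed.

(** All the cells have measure [rho^-1], except that of 0, which is null. *)
Lemma Rintegral_step_function :
  \int[mu]_t w (outward_index rho t) = rho^-1 * (\sum_(v <- s) w v - w 0).
Proof.
under eq_Rintegral do rewrite step_functionE.
rewrite Rintegral_sum//; last exact: integrable_cell_cst.
have E v : \int[mu]_t (w v * \1_(cell rho v) t) = w v * (if v == 0 then 0 else rho^-1).
  rewrite RintegralZl//; last exact: integrable_indic_cell.
  rewrite /Rintegral integral_indic//; last exact: measurable_cell.
  by rewrite setIT [X in fine X]lebesgue_measure_cell.
under eq_bigr do rewrite E.
have [s0|s0] := boolP (0 \in s).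
  rewrite !(bigD1_seq _ s0)//= mulr0 add0r [w 0 + _]addrC addrK mulr_sumr.
  by apply: eq_bigr => v /negPf ->; rewrite mulrC.
rewrite (w_supp s0) subr0 mulr_sumr !big_seq; apply: eq_bigr => v vs.
by rewrite (negPf (memPn s0 _ vs)) mulrC.
Qed.

End Cells.

(** * Comparing a trigonometric sum with a Fourier integral *)

Section Lipschitz.
Context {R : realType}.

Lemma is_derive_lipschitz1 (f df : R -> R) :
  (forall x : R, is_derive x 1 f (df x)) -> (forall x, `|df x| <= 1) ->
  forall x y, `|f x - f y| <= `|x - y|.
Proof.
move=> fd df1; have fc : continuous f.
  by move=> x; apply/differentiable_continuous/derivable1_diffP; apply: ex_derive.
have H x y : x <= y -> `|f x - f y| <= `|x - y|.
  move=> xy; have [|c _ E] := MVT_segment xy (fun x _ => fd x).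
    exact: continuous_subspaceT.
  by rewrite distrC E normrM distrC ler_piMl.
move=> x y; have [xy|/ltW yx] := leP x y; first exact: H.
by rewrite distrC [leRHS]distrC H.
Qed.

Lemma cos_lipschitz1 (x y : R) : `|cos x - cos y| <= `|x - y|.
Proof.
apply: (@is_derive_lipschitz1 cos (fun x => - sin x)) => z.
by rewrite normrN sin_max.
Qed.

Lemma sin_lipschitz1 (x y : R) : `|sin x - sin y| <= `|x - y|.
Proof. by apply: (@is_derive_lipschitz1 sin cos) => z; exact: cos_max. Qed.

End Lipschitz.

Section TransformError.
Context {R : realType}.
Notation mu := (@lebesgue_measure R).
Variables (C : R -> R) (tau : R -> R).
Hypothesis C_int : mu.-integrable setT (EFin \o C).
Hypothesis tau_le1 : forall x, `|tau x| <= 1.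
Hypothesis tau_lip : forall x y, `|tau x - tau y| <= `|x - y|.

Lemma lipschitz1_continuous : continuous tau.
Proof.
move=> x; apply/cvgrPdist_le => e e0.
near=> y; apply: le_trans (tau_lip _ _) _.
by near: y; exact: cvgr_dist_le.
Unshelve. all: by end_near. Qed.

Lemma integrable_mul_tau (lambda : R) :
  mu.-integrable setT (EFin \o (fun t => C t * tau (t * lambda))).
Proof.
apply: le_integrable C_int => //.
  apply/measurable_EFinP; apply: measurable_funM.
    by apply/measurable_EFinP; exact: measurable_int C_int.
  apply: continuous_measurable_fun => x.
  apply: continuous_comp; last exact: lipschitz1_continuous.
  exact: mulrr_continuous.
move=> t _ /=; rewrite lee_fin normrM ler_piMr//.
Qed.

(** The key to uniformity: [lambda] enters the error bound only through [M].
    The three terms come respectively from the index 0, which no cell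
    accounts for, from the distance in L1 between the step function and [C],
    and from the displacement of [t] to the grid, of length at most [rho^-1],
    inside the 1-Lipschitz factor [tau]. *)
Lemma step_transform_error (rho lambda M : R) (w : int -> R) (s : seq int) :
  0 < rho -> `|lambda| <= M -> uniq s -> (forall v, v \notin s -> w v = 0) ->
  `|rho^-1 * \sum_(v <- s) (w v * tau (v%:~R * lambda / rho)) -
    \int[mu]_t (C t * tau (t * lambda))| <=
  rho^-1 * `|w 0| + \int[mu]_t `|w (outward_index rho t) - C t| +
  rho^-1 * M * \int[mu]_t `|C t|.
Proof.
move=> rho0 lM us w0.
pose g v := w v * tau (v%:~R * lambda / rho).
have g0 v : v \notin s -> g v = 0 by move=> vs; rewrite /g w0 ?mul0r.
have gi := step_function_integrable rho0 us g0.
have wi := step_function_integrable rho0 us w0.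
have dgi : mu.-integrable setT
    (EFin \o (fun t => g (outward_index rho t) - C t * tau (t * lambda))).
  exact: (integrableB measurableT gi (integrable_mul_tau lambda)).
have dwi : mu.-integrable setT
    (EFin \o (fun t => `|w (outward_index rho t) - C t|)).
  exact: (integrable_norm (integrableB measurableT wi C_int)).
have Ci : mu.-integrable setT (EFin \o (fun t => rho^-1 * M * `|C t|)).
  exact: (integrableZl measurableT (rho^-1 * M) (integrable_norm C_int)).
have -> : rho^-1 * \sum_(v <- s) g v - \int[mu]_t (C t * tau (t * lambda)) =
    rho^-1 * g 0 + \int[mu]_t (g (outward_index rho t) - C t * tau (t * lambda)).
  rewrite RintegralB//; last exact: integrable_mul_tau.
  rewrite (Rintegral_step_function rho0 us g0); ring.
rewrite -addrA; apply: le_trans (ler_normD _ _) _; apply: lerD.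
  rewrite normrM gtr0_norm ?invr_gt0// ler_pM2l ?invr_gt0//.
  by rewrite normrM ler_piMr.
apply: le_trans (le_normr_Rintegral _ dgi) _ => //.
rewrite -RintegralZl//; last exact: integrable_norm C_int.
rewrite -RintegralD//.
apply: le_Rintegral => //.
- exact: integrable_norm.
- exact: (integrableD measurableT dwi Ci).
move=> t _; rewrite /g; set v := outward_index rho t.
have -> : w v * tau (v%:~R * lambda / rho) - C t * tau (t * lambda) =
    (w v - C t) * tau (v%:~R * lambda / rho) +
    C t * (tau (v%:~R * lambda / rho) - tau (t * lambda)) by ring.
apply: le_trans (ler_normD _ _) _; rewrite !normrM; apply: lerD.
  by rewrite ler_piMr.
rewrite mulrC ler_wpM2r//; apply: le_trans (tau_lip _ _) _.
have -> : v%:~R * lambda / rho - t * lambda = (v%:~R / rho - t) * lambda by ring.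
by rewrite normrM ler_pM// outward_index_dist.
Qed.

End TransformError.

(** * Convergence in L1 of the weighted covariances *)

Section CovarianceMajorant.
Context {R : realType}.
Notation mu := (@lebesgue_measure R).
Variable C : R -> R.
Hypothesis C_even : forall t, C (- t) = C t.
Hypothesis C_bounded : forall t, `|C t| <= C 0.

Lemma h0_fin_num t : h0 C t \is a fin_num.
Proof.
rewrite fin_numElt; apply/andP; split.
  apply: (@lt_le_trans _ _ (`|C `|t| |%:E)); first exact: ltNyr.
  by apply: ereal_sup_ubound; exists `|t| => //=.
apply: (@le_lt_trans _ _ (C 0)%:E); last exact: ltry.
by apply: ge_ereal_sup => _ [s _ <-]; rewrite lee_fin.
Qed.

Lemma normr_covariance_le_h0 s t : `|t| <= `|s| -> `|C s| <= fine (h0 C t).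
Proof.
move=> ts; rewrite -lee_fin fineK ?h0_fin_num//.
apply: ereal_sup_ubound; exists `|s| => //=.
by congr (`|_|%:E); case: (ger0P s).
Qed.

End CovarianceMajorant.

Section Weights.
Context {R : realType}.
Notation mu := (@lebesgue_measure R).
Variables (C K : R -> R) (b rho : R^nat).

(** The mean of [gamma_hat n v] times the kernel factor.  The subtraction
    [n - `|v|] is truncated, so the weight vanishes by itself outside the range
    [`|v| < n] of the estimator. *)
Definition lag_weight (n : nat) (v : int) : R :=
  (n - `|v|)%:R / n%:R * C (v%:~R / rho n) * K (b n * v%:~R).

Definition lags (n : nat) : set int := [set v : int | `|v| < n%:Z].

Lemma finite_lags n : finite_set (lags n).
Proof.
apply: (sub_finite_set _ (finite_seq [seq k%:Z - n%:Z | k <- iota 0 (2 * n)])).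
move=> v; rewrite /lags /= => vn; apply/mapP; exists `|(v + n%:Z)%R|%N; last lia.
by rewrite mem_iota; lia.
Qed.

Lemma lag_weight_supp n v : v \notin (fset_set (lags n) : seq int) ->
  lag_weight n v = 0.
Proof.
move=> vs; rewrite /lag_weight (_ : (n - `|v|)%N = 0)%N ?mul0r//.
have : ~ lags n v.
  move=> vn; move/negP: vs; apply.
  suff : v \in fset_set (lags n) by [].
  by rewrite in_fset_set; [exact: mem_set|exact: finite_lags].
rewrite /lags /=; lia.
Qed.

Hypothesis C_even : forall t, C (- t) = C t.
Hypothesis C_bounded : forall t, `|C t| <= C 0.
Hypothesis C_cont : continuous C.
Hypothesis h0_int : mu.-integrable setT (h0 C).

Variable B : R.
Hypothesis K_bounded : forall x, `|K x| <= B.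
Hypothesis K_cont : continuous K.
Hypothesis K0 : K 0 = 1.
Hypothesis b_gt0 : forall n, 0 < b n.
Hypothesis rho_gt0 : forall n, 0 < rho n.
Hypothesis nb_cvg : n%:R * b n @[n --> \oo] --> +oo.
Hypothesis rho_cvg : rho n @[n --> \oo] --> +oo.
Hypothesis rhob_cvg : rho n * b n @[n --> \oo] --> 0.

Lemma normr_lag_weight_le n v :
  `|lag_weight n v| <= `|C (v%:~R / rho n)| * B.
Proof.
rewrite /lag_weight !normrM ler_pM//.
rewrite ler_piMl// -normrM ger0_norm; last by rewrite divr_ge0.
have [->|n0] := eqVneq n 0%N; first by rewrite sub0n mul0r.
rewrite ler_pdivrMr ?ltr0n ?lt0n// mul1r ler_nat; exact: leq_subr.
Qed.

Lemma rhoV_cvg : (rho n)^-1 @[n --> \oo] --> 0.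
Proof. by apply/gtr0_cvgV0 => //; exact: nearW. Qed.

(** Along the rounded indices, the triangular factor, the kernel factor and
    the covariance factor tend to 1, [K 0 = 1] and [C t]. *)
Lemma lag_weight_cvg t :
  lag_weight n (outward_index (rho n) t) @[n --> \oo] --> C t.
Proof.
pose N n := outward_index (rho n) t.
have Nt : (N n)%:~R / rho n @[n --> \oo] --> t.
  apply/cvgrPdist_le => e e0.
  near=> n; rewrite distrC; apply: le_trans (outward_index_dist (rho_gt0 n) t) _.
  near: n; have /cvgrPdist_le := rhoV_cvg => /(_ e e0).
  by apply: filterS => n; rewrite sub0r normrN; exact: le_trans (ler_norm _).
have bN : b n * (N n)%:~R @[n --> \oo] --> 0.
  rewrite [X in X @ _](_ : _ = fun n => rho n * b n * ((N n)%:~R / rho n)).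
    by rewrite -(mul0r t); apply: cvgM.
  by apply/funext => n; field; rewrite gt_eqF.
(* The index grows like [rho n], which is negligible before [n] since
   [rho n / n] is [rho n * b n] over [n * b n]. *)
have nbV : (n%:R * b n)^-1 @[n --> \oo] --> 0.
  apply/gtr0_cvgV0; last exact: nb_cvg.
  by near=> n; rewrite mulr_gt0// ltr0n; near: n; exists 1%N.
have Nn : `|N n|%N%:R / n%:R @[n --> \oo] --> (0 : R).
  have -> : (0 : R) = `|t| * 0 * 0 by rewrite mulr0.
  have : `|(N n)%:~R / rho n| * (rho n * b n) * (n%:R * b n)^-1 @[n --> \oo]
      --> `|t| * 0 * 0.
    by apply: cvgM => //; apply: cvgM => //; exact: cvg_norm.
  apply: cvg_trans; apply: near_eq_cvg; near=> n.
  have n0 : n%:R != 0 :> R by rewrite pnatr_eq0 -lt0n; near: n; exists 1%N.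
  rewrite normrM [ `|_^-1|]gtr0_norm ?invr_gt0// -intr_norm natr_absz.
  by field; rewrite n0 !gt_eqF.
have trian : (n - `|N n|)%:R / n%:R @[n --> \oo] --> (1 : R).
  apply: (@squeeze_cvgr _ _ _ _ (fun n => 1 - `|N n|%N%:R / n%:R) (fun=> 1)).
  - near=> n; have n0 : (0 < n)%N by near: n; exists 1%N.
    have n0R : 0 < n%:R :> R by rewrite ltr0n.
    apply/andP; split; last by rewrite ler_pdivrMr// mul1r ler_nat leq_subr.
    rewrite ler_pdivlMr// mulrBl mul1r divfK ?gt_eqF// lerBlDr -natrD ler_nat.
    by rewrite addnC -leq_subLR.
  - by rewrite -[X in _ --> X](subr0 (1 : R)); apply: cvgB => //; exact: cvg_cst.
  - exact: cvg_cst.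
have -> : C t = 1 * C t * K 0 by rewrite K0 mul1r mulr1.
apply: cvgM; first (apply: cvgM => //).
- by apply: continuous_cvg => //; exact: C_cont.
- by apply: continuous_cvg => //; exact: K_cont.
Unshelve. all: by end_near. Qed.

Lemma integrable_fine_h0 : mu.-integrable setT (EFin \o (fun t => fine (h0 C t))).
Proof.
rewrite (_ : EFin \o _ = h0 C)//; apply/funext => t.
by rewrite /= fineK// h0_fin_num.
Qed.

Lemma integrable_covariance : mu.-integrable setT (EFin \o C).
Proof.
apply: le_integrable integrable_fine_h0 => //.
  by apply/measurable_EFinP; exact: continuous_measurable_fun.
move=> t _ /=; rewrite lee_fin; apply: le_trans (ler_norm _).
exact: normr_covariance_le_h0.
Qed.

(** Dominated convergence with majorant [B * h0 C]: outward rounding gives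
    [|t| <= |v / rho n|], hence [|C (v / rho n)| <= h0 C t]. *)
Lemma step_weight_cvg_L1 :
  \int[mu]_t `|lag_weight n (outward_index (rho n) t) - C t| @[n --> \oo] --> 0.
Proof.
pose f n t := (lag_weight n (outward_index (rho n) t))%:E.
have fi n := step_function_integrable (rho_gt0 n) (fset_uniq (fset_set (lags n)))
  (@lag_weight_supp n).
have [] := @dominated_convergence _ _ _ mu setT measurableT f (EFin \o C)
  (EFin \o (fun t => B * fine (h0 C t))).
- by move=> n; exact: measurable_int (fi n).
- by apply/measurable_EFinP; exact: continuous_measurable_fun.
- apply/nearW => t _; apply/fine_cvgP; split; first exact: nearW.
  exact: lag_weight_cvg.
- exact: (integrableZl measurableT B integrable_fine_h0).
- apply/nearW => t n _; rewrite /f /= lee_fin mulrC.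
  apply: le_trans (normr_lag_weight_le _ _) _.
  rewrite ler_wpM2r//; first exact: le_trans (K_bounded 0).
  by apply: normr_covariance_le_h0 => //; exact: norm_le_outward_index.
move=> _ /fine_cvgP[_ +] _; apply: cvg_trans; apply: near_eq_cvg.
by near=> n; rewrite /Rintegral.
Unshelve. all: by end_near. Qed.

End Weights.

(** * The mean of the estimator *)

Section EstimatorMean.
Context d (T : measurableType d) (R : realType) (P : probability T R).
Variables (X : R -> {RV P >-> R}) (C K : R -> R) (b rho : R^nat).
Hypothesis X2 : forall t, (X t : T -> R) \in Lfun P 2%:E.
Hypothesis XC : is_covariance_function X C.

Lemma integrable_gamma_hat n v : P.-integrable setT (EFin \o gamma_hat X rho n v).
Proof.
apply: (integrableZl measurableT n%:R^-1 (f := EFin \o _)).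
by apply: integrable_sumr => // j; exact: Lfun2_integrable_mul.
Qed.

Lemma Rintegral_gamma_hat n v :
  \int[P]_w gamma_hat X rho n v w = (n - `|v|)%:R / n%:R * C (v%:~R / rho n).
Proof.
have Xi (j : nat) := Lfun2_integrable_mul (X2 (j%:R / rho n))
  (X2 ((j + `|v|)%:R / rho n)).
rewrite /gamma_hat RintegralZl//; last first.
  by apply: integrable_sumr => // j; exact: Xi.
rewrite Rintegral_sum//.
have E (j : nat) : \int[P]_w (X (j%:R / rho n) w * X ((j + `|v|)%:R / rho n) w) =
    C (v%:~R / rho n).
  rewrite (Rintegral_lag XC) -mulrBl natrD addrAC subrr add0r natr_absz.
  rewrite intr_norm; case: (ger0P (v%:~R : R)) => // _.
  by rewrite mulNr (covariance_even XC).
under eq_bigr do rewrite E.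
rewrite sumr_const_nat subn1 /= -mulr_natl; ring.
Qed.

Lemma Rintegral_weighted_gamma_hat n (c : R) (a : int -> R) (s : seq int) :
  \int[P]_w (c * \sum_(v <- s) (gamma_hat X rho n v w * K (b n * v%:~R) * a v)) =
  c * \sum_(v <- s) (lag_weight C K b rho n v * a v).
Proof.
have gi v : P.-integrable setT
    (EFin \o (fun w => gamma_hat X rho n v w * K (b n * v%:~R) * a v)).
  rewrite (_ : EFin \o _ = (fun w => (K (b n * v%:~R) * a v)%:E *
      (EFin \o gamma_hat X rho n v) w)%E).
    exact: (integrableZl measurableT _ (integrable_gamma_hat n v)).
  by apply/funext => w; rewrite /= -EFinM; congr (_%:E); ring.
rewrite RintegralZl//; last first.
  by apply: integrable_sumr => // v; exact: gi.
rewrite Rintegral_sum//; congr (_ * _); apply: eq_bigr => v _.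
under eq_Rintegral do rewrite -mulrA mulrC.
rewrite RintegralZl//; last exact: integrable_gamma_hat.
by rewrite Rintegral_gamma_hat /lag_weight; ring.
Qed.

(** In the band [`|lambda| <= pi * rho n] the indicator function is 1; real and
    imaginary parts separate because all the other factors are real. *)
Lemma phi_hatE n lambda w : 0 < rho n -> `|lambda| <= pi * rho n ->
  phi_hat X K b rho n lambda w =
  ((2 * pi * rho n)^-1 * \sum_(v <- fset_set (lags n))
    (gamma_hat X rho n v w * K (b n * v%:~R) * cos (- (v%:~R * lambda / rho n)))) +i*
  ((2 * pi * rho n)^-1 * \sum_(v <- fset_set (lags n))
    (gamma_hat X rho n v w * K (b n * v%:~R) * sin (- (v%:~R * lambda / rho n)))).
Proof.
move=> r0 ln; rewrite /phi_hat indicE mem_set /=; last first.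
  by rewrite in_itv /= -ler_norml.
rewrite fsbig_finite /=; last exact: finite_lags.
have sumC (s : seq int) (f g : int -> R) :
    \sum_(v <- s) (f v +i* g v) = (\sum_(v <- s) f v) +i* (\sum_(v <- s) g v).
  elim: s => [|v s IH]; first by rewrite !big_nil.
  by rewrite !big_cons IH.
under eq_bigr => v _.
  rewrite (_ : _ * _ = (gamma_hat X rho n v w * K (b n * v%:~R) *
      cos (- (v%:~R * lambda / rho n))) +i* (gamma_hat X rho n v w *
      K (b n * v%:~R) * sin (- (v%:~R * lambda / rho n)))); last first.
    by rewrite mulr1 /expi; simpc.
  over.
by rewrite sumC; simpc.
Qed.

Lemma biasE n lambda : 0 < rho n -> `|lambda| <= pi * rho n ->
  bias X K b rho C n lambda =
  ((2 * pi)^-1 * ((rho n)^-1 * \sum_(v <- fset_set (lags n))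
      (lag_weight C K b rho n v * cos (- (v%:~R * lambda / rho n))) -
    \int[lebesgue_measure]_t (C t * cos (- (t * lambda))))) +i*
  ((2 * pi)^-1 * ((rho n)^-1 * \sum_(v <- fset_set (lags n))
      (lag_weight C K b rho n v * sin (- (v%:~R * lambda / rho n))) -
    \int[lebesgue_measure]_t (C t * sin (- (t * lambda))))).
Proof.
move=> r0 ln; rewrite /bias /cexpectation /spectral_density /cintegral /expi.
rewrite unlock.
under [X in fine X +i* _]eq_integral do rewrite phi_hatE//=.
under [X in _ +i* fine X]eq_integral do rewrite phi_hatE//=.
rewrite -![fine _]/(Rintegral _ _ _) !Rintegral_weighted_gamma_hat.
under [X in _ * (X +i* _)]eq_Rintegral do rewrite /= mul0r subr0.
under [X in _ * (_ +i* X)]eq_Rintegral do rewrite /= mul0r addr0.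
simpc; rewrite invfM.
by congr (_ +i* _); ring.
Qed.

End EstimatorMean.

(** * Uniform convergence of the bias *)

Lemma normc_le_add (R : realType) (x y : R) :
  `|x +i* y| <= (`|x| + `|y|)%:C.
Proof.
rewrite normc_def lecR /= -(ger0_norm (addr_ge0 (normr_ge0 x) (normr_ge0 y))).
rewrite -sqrtr_sqr ler_sqrt ?sqr_ge0// sqrrD !real_normK ?num_real//.
by have := mulr_ge0 (normr_ge0 x) (normr_ge0 y); lra.
Qed.

Lemma uniform_cvg0_majorant (R : realType) (A : set R) (f : nat -> R -> R[i])
    (e : R^nat) :
  (\forall n \near \oo, forall x, A x -> `|f n x| <= (e n)%:C) ->
  e n @[n --> \oo] --> 0 ->
  {uniform A, f @ \oo --> (fun=> 0 : (R[i] : numFieldType))}.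
Proof.
move=> fe e0 Q /uniform_nbhs [E [/= entE EQ]].
move: entE; rewrite -entourage_ballE => -[r /= r0 rE].
have rR : r = (complex.Re r)%:C by rewrite RRe_real// gtr0_real.
have {}r0 : 0 < complex.Re r by move: r0; rewrite rR ltcR.
have /cvgr0Pnorm_lt /(_ _ r0) er := e0.
near=> n; apply: EQ => x Ax /=; apply: rE; rewrite /= -ball_normE /=.
rewrite sub0r normrN rR; apply: (@le_lt_trans _ _ (e n)%:C).
  by move: x Ax; near: n.
rewrite ltcR; apply: le_lt_trans (ler_norm _) _.
by near: n.
Unshelve. all: by end_near. Qed.

Theorem theorem1 (R : realType) (d : measure_display) (T : measurableType d)
    (P : probability T R) (X : R -> {RV P >-> R}) (C : R -> R)
    (K : R -> R) (b rho : R^nat) :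
  zero_mean X ->
  mean_square_continuous X ->
  wide_sense_stationary X ->
  is_covariance_function X C ->
  (forall n, 0 < b n) ->
  (forall n, 0 < rho n) ->
  lebesgue_measure.-integrable setT (h0 C) ->
  kernel_condition K ->
  b n @[n --> \oo] --> 0 ->
  n%:R * b n @[n --> \oo] --> +oo ->
  rho n @[n --> \oo] --> +oo ->
  rho n * b n @[n --> \oo] --> 0 ->
  forall u v : R,
    {uniform `[u, v], bias X K b rho C @ \oo --> (fun=> 0 : (R[i] : numFieldType))}.
Proof.
move=> _ msc [X2 _ _] XC b0 r0 h0i [Kc _ _ [g [g0 _ _ gmax Kg]] K0] _ nb rc rb u v.
(* The majorant of the kernel is largest at 0, so it bounds the kernel. *)
have Kb x : `|K x| <= g 0.
  apply: le_trans (Kg x) _.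
  by have [->//|/gmax/ltW] := eqVneq x 0.
have Ceven := covariance_even XC.
have Cbd := normr_covariance_le X2 XC.
have Cc := covariance_continuous X2 XC msc.
have Ci := integrable_covariance Ceven Cbd Cc h0i.
pose a := lag_weight C K b rho.
pose M := `|u| + `|v|.
(* The bound on each component of the bias, before the factor [(2 * pi)^-1]. *)
pose e n := (rho n)^-1 * `|a n 0| +
  \int[lebesgue_measure]_t `|a n (outward_index (rho n) t) - C t| +
  (rho n)^-1 * M * \int[lebesgue_measure]_t `|C t|.
have rV : (rho n)^-1 @[n --> \oo] --> 0 := rhoV_cvg r0 rc.
have a0 n : `|a n 0| <= C 0 * g 0.
  apply: le_trans (normr_lag_weight_le C b rho Kb n 0) _.
  by rewrite ler_wpM2r// ?g0.
have e_cvg : pi^-1 * e n @[n --> \oo] --> 0.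
  have cvg0Mr (f : R^nat) k : f n @[n --> \oo] --> 0 -> f n * k @[n --> \oo] --> 0.
    by move=> f0; rewrite -(mul0r k); apply: cvgM => //; exact: cvg_cst.
  under eq_cvg do rewrite mulrC; apply: (cvg0Mr e).
  have -> : (0 : R) = 0 + 0 + 0 by rewrite !addr0.
  apply: cvgD; first apply: cvgD.
  - apply: (@squeeze_cvgr _ _ _ _ (fun=> 0) (fun n => (rho n)^-1 * (C 0 * g 0))).
    + apply/nearW => n; have rn : 0 <= (rho n)^-1 by rewrite invr_ge0 ltW.
      by rewrite mulr_ge0//= ler_wpM2l.
    + exact: cvg_cst.
    + exact: cvg0Mr.
  - exact: (step_weight_cvg_L1 Ceven Cbd Cc h0i Kb Kc K0 b0 r0 nb rc rb).
  - by do 2 apply: (cvg0Mr _ _).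
apply: uniform_cvg0_majorant e_cvg.
(* The band of the estimator eventually contains the whole interval. *)
have Mr : \forall n \near \oo, M <= pi * rho n.
  near=> n; rewrite -ler_pdivrMl ?pi_gt0//; near: n.
  by apply: (cvgryPge _).1.
apply: filterS Mr => n Mn lambda; rewrite /= in_itv /= => /andP[ul lv].
have lM : `|lambda| <= M.
  rewrite /M ler_norml; apply/andP; split.
    have := ler_norm (- u); rewrite normrN; have := normr_ge0 v; lra.
  by have := ler_norm v; have := normr_ge0 u; lra.
rewrite (biasE K b X2 XC (r0 n) (le_trans lM Mn)).
have us := fset_uniq (fset_set (lags n)).
have ws := @lag_weight_supp _ C K b rho n.
have err (tau : R -> R) (t1 : forall x, `|tau x| <= 1)
    (tl : forall x y, `|tau x - tau y| <= `|x - y|) :=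
  step_transform_error Ci t1 tl (r0 n) lM us ws.
have opp_lip (x y : R) : `|- x - - y| <= `|x - y|.
  by rewrite -opprD normrN.
have cosE := err (fun x => cos (- x)) (fun x => cos_max (- x))
  (fun x y => le_trans (cos_lipschitz1 _ _) (opp_lip x y)).
have sinE := err (fun x => sin (- x)) (fun x => sin_max (- x))
  (fun x y => le_trans (sin_lipschitz1 _ _) (opp_lip x y)).
have p0 : 0 < (2 * pi : R)^-1 by rewrite invr_gt0 mulr_gt0// pi_gt0.
apply: le_trans (normc_le_add _ _) _; rewrite lecR !normrM.
rewrite [ `|(2 * pi)^-1|]gtr0_norm// -mulrDr.
have -> : pi^-1 * e n = (2 * pi)^-1 * (e n + e n).
  by rewrite invfM; move: (pi^-1) (e n) => p z; field.
by rewrite ler_pM2l//; apply: lerD.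
Unshelve. all: by end_near. Qed.
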